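(* Let $g:\mathbb{R}^m\to\overline{\mathbb{R}}$ and $F:\mathbb{R}^n\to\mathbb{R}^m\cup\{+\infty_\bullet\}$. Let $g\circ F:\mathbb{R}^n\to\overline{\mathbb{R}}$ be given by $(g\circ F)(x)=g(F(x))$ if $x\in\operatorname{dom}(F)$ and $+\infty$ otherwise, and let $f:\mathbb{R}^n\times\mathbb{R}^m\to\overline{\mathbb{R}}$ be given by $f(x,u)=g(F(x)+u)$ if $x\in\operatorname{dom}(F)$ and $+\infty$ otherwise (so $(g\circ F)(x)=f(x,0)$). If $g\in\Gamma(\mathbb{R}^m)$, then (a) $\mathcal{K}_F\cap\mathcal{K}_{g,\operatorname{rge}(F)}\neq\emptyset$ implies that $g\circ F$ is convex; (b) $\mathcal{K}_F\cap\mathcal{K}_g\neq\emptyset$ implies that $f$ is convex. If $g\in\Gamma_0(\mathbb{R}^m)$ and $\operatorname{dom}(g)\cap\operatorname{rge}(F)\neq\emptyset$, then (b) is an equivalence: $\mathcal{K}_F\cap\mathcal{K}_g\neq\emptyset$ if and only if $f$ is convex.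
   Context: $\overline{\mathbb{R}}=\mathbb{R}\cup\{-\infty,+\infty\}$. For $h:\mathbb{R}^p\to\overline{\mathbb{R}}$, $\operatorname{dom}(h)=\{x:h(x)<+\infty\}$ and $\operatorname{epi}(h)=\{(x,\alpha)\in\mathbb{R}^p\times\mathbb{R}:h(x)\le\alpha\}$; $h$ is convex (closed) if $\operatorname{epi}(h)$ is convex (closed), and proper if $h\not\equiv+\infty$ and $h>-\infty$ everywhere. $\Gamma(\mathbb{R}^p)$ is the set of proper convex functions, $\Gamma_0(\mathbb{R}^p)$ the set of closed proper convex functions. $+\infty_\bullet$ is an extra ''infinite element'' adjoined to $\mathbb{R}^m$; $\operatorname{dom}(F)=\{x:F(x)\neq+\infty_\bullet\}$ and $\operatorname{rge}(F)=F(\operatorname{dom}(F))\subseteq\mathbb{R}^m$. For a closed convex cone $K\subseteq\mathbb{R}^m$, $x^1\le_K x^2$ means $x^2-x^1\in K$. $F$ is $K$-convex if $\{(x,z)\in\operatorname{dom}(F)\times\mathbb{R}^m: F(x)\le_K z\}$ is convex. $g$ is $K$-increasing if $g(w)\le g(w+k)$ for all $k\in K$, $w\in\mathbb{R}^m$; $g$ is $K$-increasing restricted to $\operatorname{rge}(F)$ if $g(w)\le g(w+k)$ for all $k\in K$, $w\in\operatorname{rge}(F)$. $\mathcal{K}_F$, $\mathcal{K}_g$, $\mathcal{K}_{g,\operatorname{rge}(F)}$ denote the sets of closed convex cones $K\subseteq\mathbb{R}^m$ such that, respectively, $F$ is $K$-convex, $g$ is $K$-increasing, $g$ is $K$-increasing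 restricted to $\operatorname{rge}(F)$. *)

(* Defs.v *)
From HB Require Import structures.
From mathcomp Require Import all_boot all_order all_algebra.
From mathcomp Require Import all_classical all_reals all_analysis.

Set Implicit Arguments.
Unset Strict Implicit.
Unset Printing Implicit Defensive.

Import Order.TTheory GRing.Theory Num.Theory.
Import numFieldNormedType.Exports.

Local Open Scope classical_set_scope.
Local Open Scope ring_scope.

(* R^p is 'rV[R]_p, and R^n x R^m is the product
   type 'rV[R]_n * 'rV[R]_m.  In E * R^o, the R^o is the real line seen as a
   normed module over itself. *)

Section ExtendedRealValued.
Context {R : realType}.

Definition edom (E : Type) (h : E -> \bar R) : set E :=
  [set x | (h x < +oo)%E].

Definition epi (E : Type) (h : E -> \bar R) : set (E * R^o) :=
  [set xa | (h xa.1 <= (xa.2 : R)%:E)%E].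

Definition econvex (E : lmodType R) (h : E -> \bar R) : Prop :=
  convex_set (epi h).

Definition eclosed (E : normedModType R) (h : E -> \bar R) : Prop :=
  closed (epi h).

Definition eproper (E : Type) (h : E -> \bar R) : Prop :=
  (exists x, h x <> +oo%E) /\ (forall x, (-oo < h x)%E).

Definition Gamma (E : lmodType R) : set (E -> \bar R) :=
  [set h | eproper h /\ econvex h].

Definition Gamma0 (E : normedModType R) : set (E -> \bar R) :=
  [set h | Gamma h /\ eclosed h].

End ExtendedRealValued.

Section Cones.
Context {R : realType} {V : normedModType R}.

(* Cones are nonempty: with the empty set allowed, every F would be K-convex
   and every g would be K-increasing for K the empty set. *)
Definition is_cone (K : set V) : Prop :=
  K !=set0 /\ (forall (t : R) k, 0 <= t -> K k -> K (t *: k)).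

Definition closed_convex_cone (K : set V) : Prop :=
  [/\ is_cone K, convex_set K & closed K].

Definition cone_le (K : set V) (x1 x2 : V) : Prop := K (x2 - x1).

Definition cone_increasing (K : set V) (g : V -> \bar R) : Prop :=
  forall k w, K k -> (g w <= g (w + k)%R)%E.

Definition cone_increasing_on (K A : set V) (g : V -> \bar R) : Prop :=
  forall k w, K k -> A w -> (g w <= g (w + k)%R)%E.

End Cones.

(* A map into R^m with an adjoined infinite element has codomain
   option 'rV[R]_m, where None is the infinite element. *)
Section VectorValued.
Context {R : realType} {n m : nat}.
Implicit Types (F : 'rV[R]_n -> option 'rV[R]_m) (g : 'rV[R]_m -> \bar R).

Definition vrge F : set 'rV[R]_m := [set w | exists x, F x = Some w].

Definition cone_epi (K : set 'rV[R]_m) F : set ('rV[R]_n * 'rV[R]_m) :=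
  [set xz | exists2 w, F xz.1 = Some w & cone_le K w xz.2].

Definition cone_convex (K : set 'rV[R]_m) F : Prop :=
  convex_set (cone_epi K F).

Definition KF F : set (set 'rV[R]_m) :=
  [set K | closed_convex_cone K /\ cone_convex K F].

Definition Kg g : set (set 'rV[R]_m) :=
  [set K | closed_convex_cone K /\ cone_increasing K g].

Definition Kg_rge g F : set (set 'rV[R]_m) :=
  [set K | closed_convex_cone K /\ cone_increasing_on K (vrge F) g].

Definition ecomp g F (x : 'rV[R]_n) : \bar R :=
  if F x is Some w then g w else +oo%E.

Definition perturbed g F (xu : 'rV[R]_n * 'rV[R]_m) : \bar R :=
  if F xu.1 is Some w then g (w + xu.2) else +oo%E.

End VectorValued.

(* Main.v *)
(** For the converse take K to be the set of k such that g does not increase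
along -k, i.e. the opposite of the recession cone of g; it is closed because
epi g is.  Given F x = v and F y = w, convexity of f at the points (x, c - v)
and (y, c - w), where f takes the value g c, first shows (with c in dom g) that
F (t x + (1 - t) y) is some z, and then that
g (c - (t v + (1 - t) w - z)) <= g c for every c: so t v + (1 - t) w - z is in
K, which is K-convexity of F. *)

Require Import Defs.
From HB Require Import structures.
From mathcomp Require Import all_boot all_order all_algebra.
From mathcomp Require Import all_classical all_reals all_analysis.

Set Implicit Arguments.
Unset Strict Implicit.
Unset Printing Implicit Defensive.

Import Order.TTheory GRing.Theory Num.Theory.
Import numFieldNormedType.Exports.

Local Open Scope classical_set_scope.
Local Open Scope ring_scope.

Lemma convex_setP (R : realType) (M : lmodType R) (A : set M) :
  convex_set A <-> forall x y (t : R), 0 <= t -> t <= 1 -> A x -> A y ->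
    A (t *: x + (1 - t) *: y).
Proof.
split=> [cA x y t t0 t1 Ax Ay|cA x y t /[!inE] Ax Ay].
  by have := cA x y (Itv01 t0 t1); rewrite !inE; exact.
exact: cA.
Qed.

Lemma econvexP (R : realType) (E : lmodType R) (h : E -> \bar R) :
  econvex h <-> forall x y (a b t : R), 0 <= t -> t <= 1 ->
    (h x <= a%:E)%E -> (h y <= b%:E)%E ->
    (h (t *: x + (1 - t) *: y)%R <= (t * a + (1 - t) * b)%R%:E)%E.
Proof.
rewrite /econvex convex_setP; split=> [ch x y a b t t0 t1 hx hy|ch].
  exact: (ch (x, a) (y, b) t).
by move=> [x a] [y b] t t0 t1 hx hy; exact: ch.
Qed.

Lemma convex_cone0 (R : realType) (V : normedModType R) (K : set V) :
  closed_convex_cone K -> K 0.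
Proof. by move=> [[[k Kk] cK] _ _]; rewrite -(scale0r k); exact: cK. Qed.

(** The sum is twice the midpoint of [k] and [l]. *)
Lemma convex_coneD (R : realType) (V : normedModType R) (K : set V) (k l : V) :
  closed_convex_cone K -> K k -> K l -> K (k + l).
Proof.
move=> [[_ coneK] /convex_setP convK _] Kk Kl.
have h0 : (0 <= 2^-1 :> R) by rewrite invr_ge0.
have h1 : (2^-1 <= 1 :> R) by rewrite invf_le1// ler1n.
have -> : k + l = 2 *: (2^-1 *: k + (1 - 2^-1) *: l).
  rewrite scalerDr !scalerA mulrBr mulr1 divff// (_ : 2 - 1 = 1) ?scale1r//.
  by rewrite -[2]/(1 + 1) addrK.
by apply: coneK => //; exact: convK.
Qed.

(** Real bounds [a] rather than [g w] itself phrase membership through [epi g], and the factor [s]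
    builds in invariance under scaling. *)
Definition opp_recession (R : realType) (V : normedModType R) (g : V -> \bar R) :
    set V :=
  [set k | forall (s a : R) w, 0 <= s -> (g w <= a%:E)%E ->
             (g (w - s *: k)%R <= a%:E)%E].

(** A move along a convex combination of [k] and [l] is a move along [k] followed by one along
    [l]. *)
Lemma opp_recession_closed_convex_cone (R : realType) (V : normedModType R)
    (g : V -> \bar R) : eclosed g -> closed_convex_cone (opp_recession g).
Proof.
move=> clg; split.
- split; first by exists 0 => s a w _; rewrite scaler0 subr0.
  move=> t k t0 Kk s a w s0 ga.
  by rewrite scalerA; apply: Kk => //; exact: mulr_ge0.
- apply/convex_setP => k l t t0 t1 Kk Kl s a w s0 ga.
  rewrite scalerDr !scalerA opprD addrA.
  by apply: Kl; [|apply: Kk => //]; rewrite mulr_ge0// subr_ge0.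
(* Closedness: each triple [(s, a, w)] contributes the preimage of [epi g] under a map continuous in
   [k]. *)
- rewrite (_ : opp_recession g =
    \bigcap_(p in [set p : R * R * V | 0 <= p.1.1 /\ (g p.2 <= p.1.2%:E)%E])
      ((fun k : V => (p.2 - p.1.1 *: k, p.1.2 : R^o)) @^-1` epi g)).
    apply: closed_bigI => -[[s a] w] _ /=.
    apply: (continuous_closedP _).1 => //.
    have cont k : (fun k' : V => w - s *: k') @ k --> w - s *: k.
      by apply: cvgB; [exact: cvg_cst|apply: cvgZr; exact: cvg_id].
    by move=> k; apply: cvg_pair (cont k) (cvg_cst _).
  apply/seteqP; split=> k Kk; first by move=> [[s a] w] [/= s0 ga]; exact: Kk.
  by move=> s a w s0 ga; exact: (Kk (s, a, w)).
Qed.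

(** Step back from [w + k] with [s = 1]; by properness [g (w + k)] is either [+oo] or a real number
    that can serve as the bound [a]. *)
Lemma opp_recession_increasing (R : realType) (V : normedModType R)
    (g : V -> \bar R) : eproper g -> cone_increasing (opp_recession g) g.
Proof.
move=> [_ gNy] k w Kk; have := gNy (w + k).
case gwk : (g (w + k)) => [r| |] // _; last by rewrite leey.
by rewrite -[w in g w](addrK k) -{2}(scale1r k); apply: Kk; rewrite ?gwk.
Qed.

(* Iterating gives the integer multiples of k; convexity interpolates between
   them. *)
Lemma opp_recessionP (R : realType) (V : normedModType R) (g : V -> \bar R) k :
  econvex g -> (forall (a : R) w, (g w <= a%:E)%E -> (g (w - k)%R <= a%:E)%E) ->
  opp_recession g k.
Proof.
move=> /econvexP cg gk s a w s0 ga.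
have gkn n : (g (w - n%:R *: k)%R <= a%:E)%E.
  elim: n => [|n IHn]; first by rewrite scale0r subr0.
  by rewrite -natr1 scalerDl scale1r opprD addrA; exact: gk.
(* A positive integer above [s], so that [w - s *: k] lies on the segment from [w] to
   [w - n%:R *: k]. *)
pose n := (Num.truncn s).+1.
have n0 : 0 < n%:R :> R by rewrite ltr0n.
have sn : s <= n%:R by apply/ltW; exact: truncnS_gt.
have -> : w - s *: k = (s / n%:R) *: (w - n%:R *: k) + (1 - s / n%:R) *: w.
  rewrite scalerBr scalerA divfK ?gt_eqF// addrAC -scalerDl addrC.
  by rewrite addrCA subrr addr0 scale1r addrC.
have -> : a = s / n%:R * a + (1 - s / n%:R) * a.
  by rewrite -mulrDl addrC subrK mul1r.
by apply: cg => //; rewrite ?divr_ge0 ?ler_pdivrMr ?mul1r// ltW.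
Qed.

Section CompositionConvexity.
Variables (R : realType) (n m : nat).
Variables (g : 'rV[R]_m -> \bar R) (F : 'rV[R]_n -> option 'rV[R]_m).

(** Since [K] contains 0, the graph of [F] lies in [cone_epi K F], so K-convexity applies to its
    points. *)
Lemma KF_conv K x y v w (t : R) : KF F K -> 0 <= t -> t <= 1 ->
  F x = Some v -> F y = Some w ->
  exists2 z, F (t *: x + (1 - t) *: y) = Some z &
             K (t *: v + (1 - t) *: w - z).
Proof.
move=> [cK /convex_setP cF] t0 t1 Fx Fy.
have K0 := convex_cone0 cK.
apply: (cF (x, v) (y, w) t) => //; first by exists v; rewrite /cone_le ?subrr.
by exists w; rewrite /cone_le ?subrr.
Qed.

(** Monotonicity is invoked only at [z], a value of [F]; convexity of [g] does the rest. *)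
Lemma econvex_ecomp :
  econvex g -> KF F `&` Kg_rge g F !=set0 -> econvex (ecomp g F).
Proof.
move=> /econvexP cg [K [KFK [_ incr]]].
apply/econvexP => x y a b t t0 t1; rewrite /ecomp.
case Fx : (F x) => [v|//] gv; case Fy : (F y) => [w|//] gw.
have [z Fz Kz] := KF_conv KFK t0 t1 Fx Fy; rewrite Fz.
apply: le_trans (cg _ _ _ _ _ t0 t1 gv gw).
rewrite -[X in (_ <= g X)%E](subrKC z).
by apply: incr => //; exists (t *: x + (1 - t) *: y).
Qed.

(** The perturbation moves the base point from [z] to [z + (t *: u + (1 - t) *: u')], which may
    leave the range of [F], whence monotonicity everywhere. *)
Lemma econvex_perturbed :
  econvex g -> KF F `&` Kg g !=set0 -> econvex (perturbed g F).
Proof.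
move=> /econvexP cg [K [KFK [_ incr]]].
apply/econvexP => -[x u] [y u'] a b t t0 t1; rewrite /perturbed/=.
case Fx : (F x) => [v|//] gv; case Fy : (F y) => [w|//] gw.
have [z Fz Kz] := KF_conv KFK t0 t1 Fx Fy; rewrite Fz.
apply: le_trans (cg _ _ _ _ _ t0 t1 gv gw).
rewrite !scalerDr addrACA -[X in (_ <= g (X + _)%R)%E](subrKC z) addrAC.
exact: incr.
Qed.

Lemma perturbed_opp_recession : eproper g -> econvex g -> eclosed g ->
  econvex (perturbed g F) -> KF F (opp_recession g).
Proof.
move=> [[w0 gw0] gNy] cg clg /econvexP cf.
have cK := opp_recession_closed_convex_cone clg; split=> //.
have {}cf x y v w t c d (a b : R) :
    0 <= t -> t <= 1 -> F x = Some v -> F y = Some w ->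
    (g c <= a%:E)%E -> (g d <= b%:E)%E ->
    (perturbed g F (t *: x + (1 - t) *: y,
       t *: (c - v) + (1 - t) *: (d - w))%R <= (t * a + (1 - t) * b)%R%:E)%E.
  move=> t0 t1 Fx Fy gc gd; apply: (cf (x, c - v) (y, d - w)) => //.
    by rewrite /perturbed/= Fx subrKC.
  by rewrite /perturbed/= Fy subrKC.
apply/convex_setP => -[x u] [y u'] t t0 t1 [v /= Fx Kv] [w /= Fy Kw].
(* A real bound at one point bounds [perturbed g F] at the combination by a real, which excludes
   [None] there. *)
have [a ga] : exists a : R, (g w0 <= a%:E)%E.
  by case: (g w0) gw0 (gNy w0) => [r|//|//] _ _; exists r.
have := cf _ _ _ _ _ _ _ _ _ t0 t1 Fx Fy ga ga.
rewrite /cone_epi /perturbed/=; case Fz : (F _) => [z|//] _; exists z => //.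
rewrite /cone_le.
(* The first summand combines the cone elements [u - v] and [u' - w]; the second is the convexity
   gap of [F] on its graph. *)
have -> : t *: u + (1 - t) *: u' - z =
   (t *: (u - v) + (1 - t) *: (u' - w)) + (t *: v + (1 - t) *: w - z).
  by rewrite addrA; congr (_ - z); rewrite addrACA -!scalerDr !subrK.
apply: (convex_coneD cK).
  by case: cK => _ /convex_setP cK _; exact: cK.
(* It remains to test unit steps: taking the same [c] at both points makes the second argument plus
   [z] equal to [c] minus the gap. *)
apply: opp_recessionP => // b c gc.
have := cf _ _ _ _ _ _ _ _ _ t0 t1 Fx Fy gc gc.
rewrite /perturbed/= Fz -mulrDl subrKC mul1r.
congr (g _ <= _)%E.
rewrite !scalerBr addrACA -scalerDl subrKC scale1r -opprD.
by rewrite opprB addrCA.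
Qed.

End CompositionConvexity.

Theorem proposition4p1 (R : realType) (n m : nat)
    (g : 'rV[R]_m -> \bar R) (F : 'rV[R]_n -> option 'rV[R]_m) :
  (Gamma g ->
     (KF F `&` Kg_rge g F !=set0 -> econvex (ecomp g F)) /\
     (KF F `&` Kg g !=set0 -> econvex (perturbed g F))) /\
  (Gamma0 g -> edom g `&` vrge F !=set0 ->
     (KF F `&` Kg g !=set0 <-> econvex (perturbed g F))).
Proof.
split=> [[_ cg]|[[pg cg] clg] _].
  by split; [exact: econvex_ecomp|exact: econvex_perturbed].
split; first exact: econvex_perturbed.
move=> cf; exists (opp_recession g); split; first exact: perturbed_opp_recession.
by split; [exact: opp_recession_closed_convex_cone|exact: opp_recession_increasing].
Qed.
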